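(* Let $\mathcal{A}_{\mathbb{Z},q}$ be the ring generated by the elements of the Habiro ring $\widehat{\mathbb{Z}[q]}$ and elements $\mu_n,\mu_n^*$ $(n\in\mathbb{N})$ subject to the relations $$(\mu_n^* )^*=\mu_n,\quad \mu_n\mu_m=\mu_{nm}\ (\forall n,m),\quad \mu_n\mu_m^*=\mu_m^*\mu_n \text{ if } (n,m)=1,\quad \mu_n^*\mu_n=1,$$ $$\mu_n\sigma_n(f)=f\mu_n,\qquad \mu_n^*f=\sigma_n(f)\mu_n^*\qquad (f\in\widehat{\mathbb{Z}[q]},\ n\in\mathbb{N}),$$ with the elements $\mu_n\mu_n^*$ required to belong to the direct limit $\widehat{\mathbb{Z}[q]}_\infty$. Then $\mathcal{A}_{\mathbb{Z},q}$ is the crossed product ring $$\mathcal{A}_{\mathbb{Z},q}=\widehat{\mathbb{Z}[q]}_\infty\rtimes\mathbb{Q}_+^*$$ of the action of the group $\mathbb{Q}_+^*$ on the ring $\widehat{\mathbb{Z}[q]}_\infty=\varinjlim_n(\sigma_n:\widehat{\mathbb{Z}[q]}\to\widehat{\mathbb{Z}[q]})$.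
   Context: $\mathbb{N}$ is the multiplicative semigroup of positive integers and $\mathbb{Q}_+^*$ the multiplicative group of positive rationals. The Habiro ring is $\widehat{\mathbb{Z}[q]}=\varprojlim_n\mathbb{Z}[q]/((q)_n)$ with $(q)_n=(1-q)(1-q^2)\cdots(1-q^n)$. For $n\in\mathbb{N}$, $\sigma_n:\widehat{\mathbb{Z}[q]}\to\widehat{\mathbb{Z}[q]}$ is the (injective) ring endomorphism $\sigma_n(f)(q)=f(q^n)$. $\widehat{\mathbb{Z}[q]}_\infty$ is the direct limit of the system of maps $\sigma_n$: the copies of $\widehat{\mathbb{Z}[q]}$ are indexed by $N\in\mathbb{N}$ ordered by divisibility, and the transition map from index $N$ to index $kN$ is $\sigma_k$. The copy with index $N$ corresponds to the elements $\mu_N f\mu_N^*$, $f\in\widehat{\mathbb{Z}[q]}$, of $\mathcal{A}_{\mathbb{Z},q}$. The $\sigma_n$ induce maps on $\widehat{\mathbb{Z}[q]}_\infty$ which are automorphisms, with inverses $\rho_n(a)=\mu_n a\mu_n^*$; the action of $r=m/n\in\mathbb{Q}_+^*$ with $(m,n)=1$ is $\rho_r(a)=\mu_m\mu_n^*\,a\,\mu_n\mu_m^*$, i.e. $\rho_r=\rho_m\circ\sigma_n$. *)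

(* Defs.v *)
From HB Require Import structures.
From mathcomp Require Import all_boot all_order all_algebra.
From mathcomp Require Import boolp.
From mathcomp Require Import finmap monalg.

Set Implicit Arguments.
Unset Strict Implicit.
Unset Printing Implicit Defensive.

Import Order.TTheory GRing.Theory Num.Theory.

Local Open Scope ring_scope.
Local Open Scope quotient_scope.

Definition posint := {n : nat | (0 < n)%N}.

Coercion nat_of_posint (n : posint) : nat := sval n.

Lemma posint_gt0 (n : posint) : (0 < n)%N. Proof. exact: svalP n. Qed.

Lemma posint_inj : injective nat_of_posint. Proof. exact: val_inj. Qed.

Definition pone : posint := exist _ 1%N isT.

Lemma pmul_proof (n m : posint) : (0 < n * m)%N.
Proof. by rewrite muln_gt0 !posint_gt0. Qed.

Definition pmul (n m : posint) : posint := exist _ (n * m)%N (pmul_proof n m).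

Lemma pmulC : commutative pmul.
Proof. by move=> n m; apply: posint_inj; rewrite /= mulnC. Qed.

Lemma pmulA : associative pmul.
Proof. by move=> n m k; apply: posint_inj; rewrite /= mulnA. Qed.

Lemma pmul1n : left_id pone pmul.
Proof. by move=> n; apply: posint_inj; rewrite /= mul1n. Qed.

Lemma pmuln1 : right_id pone pmul.
Proof. by move=> n; rewrite pmulC pmul1n. Qed.

Definition posrat := {r : rat | 0 < r}.

HB.instance Definition _ := Choice.on posrat.

Definition posrat_one : posrat := exist _ 1 ltr01.

Definition posrat_mul (r s : posrat) : posrat :=
  exist _ (val r * val s) (mulr_gt0 (valP r) (valP s)).

Lemma posrat_inv_proof (r : posrat) : 0 < (val r)^-1.
Proof. by rewrite invr_gt0 (valP r). Qed.

Definition posrat_inv (r : posrat) : posrat :=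
  exist _ (val r)^-1 (posrat_inv_proof r).

Lemma posrat_mulA : associative posrat_mul.
Proof. by move=> r s t; apply: val_inj; rewrite /= mulrA. Qed.

Lemma posrat_mul1 : left_id posrat_one posrat_mul.
Proof. by move=> r; apply: val_inj; rewrite /= mul1r. Qed.

Lemma posrat_mulr1 : right_id posrat_one posrat_mul.
Proof. by move=> r; apply: val_inj; rewrite /= mulr1. Qed.

Lemma posrat_mulV : left_inverse posrat_one posrat_inv posrat_mul.
Proof. by move=> r; apply: val_inj; rewrite /= mulVf // gt_eqF ?(valP r). Qed.

Lemma posrat_mulrV : right_inverse posrat_one posrat_inv posrat_mul.
Proof. by move=> r; apply: val_inj; rewrite /= mulfV // gt_eqF ?(valP r). Qed.

HB.instance Definition _ := isGroup.Build posrat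
  posrat_mulA posrat_mul1 posrat_mulr1 posrat_mulV posrat_mulrV.

Lemma posrat_of_proof (n : posint) : 0 < (n : nat)%:R :> rat.
Proof. by rewrite ltr0n posint_gt0. Qed.

Definition posrat_of (n : posint) : posrat :=
  exist _ (n : nat)%:R (posrat_of_proof n).

Lemma posrat_num_proof (r : posrat) : (0 < `|numq (val r)|)%N.
Proof. by rewrite absz_gt0 numq_eq0 gt_eqF ?(valP r). Qed.

Lemma posrat_den_proof (r : posrat) : (0 < `|denq (val r)|)%N.
Proof. by rewrite absz_gt0 denq_neq0. Qed.

(* [r = posrat_num r / posrat_den r] in lowest terms. *)
Definition posrat_num (r : posrat) : posint :=
  exist (fun n => (0 < n)%N) `|numq (val r)|%N (posrat_num_proof r).
Definition posrat_den (r : posrat) : posint :=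
  exist (fun n => (0 < n)%N) `|denq (val r)|%N (posrat_den_proof r).

Lemma posrat_frac (r : posrat) :
  val r = (posrat_num r : nat)%:R / (posrat_den r : nat)%:R.
Proof.
rewrite -[LHS]divq_num_den /= !pmulrn !gez0_abs ?denq_ge0 //.
by rewrite numq_ge0 ltW ?(valP r).
Qed.

(* (q)_n = (1 - q)(1 - q^2)...(1 - q^n) *)
Definition qpoch (n : nat) : {poly int} := \prod_(1 <= i < n.+1) (1 - 'X^i).

(* The ideal of Z[q] generated by (q)_{k+1}: indices are shifted since the
   limit runs over positive n, and (q)_0 = 1 would give the zero ring. *)
Definition qpoch_ideal (k : nat) : {poly int} -> bool :=
  fun p => `[< exists r, p = r * qpoch k.+1 >].

Lemma qpoch_idealP k p :
  reflect (exists r, p = r * qpoch k.+1) (p \in qpoch_ideal k).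
Proof. exact: asboolP. Qed.

Lemma qpoch_horner1 k : (qpoch k.+1).[1] = 0.
Proof.
by rewrite /qpoch big_ltn // hornerM expr1 !hornerE.
Qed.

Lemma qpoch_ideal_closed k : idealr_closed (qpoch_ideal k).
Proof.
split.
- by apply/qpoch_idealP; exists 0; rewrite mul0r.
- apply/qpoch_idealP => -[r /(congr1 (horner^~ 1))].
  by rewrite hornerM qpoch_horner1 mulr0 hornerC => /eqP; rewrite oner_eq0.
- move=> a u v /qpoch_idealP[r ->] /qpoch_idealP[s ->].
  by apply/qpoch_idealP; exists (a * r + s); rewrite mulrDl mulrA.
Qed.

HB.instance Definition _ k :=
  isIdealr.Build {poly int} (qpoch_ideal k) (qpoch_ideal_closed k).

Definition qpoch_idealr (k : nat) : idealr {poly int} := qpoch_ideal k.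

Definition Zq_mod (k : nat) := {ideal_quot (qpoch_idealr k)}.

HB.instance Definition _ k := GRing.ComNzRing.on (Zq_mod k).

Definition Zq_pi (k : nat) (p : {poly int}) : Zq_mod k :=
  \pi_{ideal_quot (qpoch_idealr k)} p.

Definition Zq_repr (k : nat) (x : Zq_mod k) : {poly int} :=
  repr (x : {ideal_quot (qpoch_idealr k)}).

Lemma Zq_reprK k x : Zq_pi k (Zq_repr x) = x.
Proof. exact: reprK. Qed.

Lemma Zq_piP k p p' :
  Zq_pi k p = Zq_pi k p' <-> exists r, p - p' = r * qpoch k.+1.
Proof.
split; first by move=> /eqP; rewrite /Zq_pi -Quotient.idealrBE => /qpoch_idealP.
move=> h; apply/eqP; rewrite /Zq_pi -Quotient.idealrBE; exact/qpoch_idealP.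
Qed.

Lemma Zq_piE k p : exists r, Zq_repr (Zq_pi k p) = p + r * qpoch k.+1.
Proof.
have /Zq_piP[r e] := Zq_reprK (Zq_pi k p).
by exists r; rewrite -e addrC subrK.
Qed.

Fact Zq_pi_is_zmod_morphism k : zmod_morphism (Zq_pi k).
Proof. by move=> p p'; rewrite /Zq_pi rmorphB. Qed.

Fact Zq_pi_is_monoid_morphism k : monoid_morphism (Zq_pi k).
Proof. by split=> [|p p']; rewrite /Zq_pi (rmorph1, rmorphM). Qed.

HB.instance Definition _ k := GRing.isZmodMorphism.Build _ _ (Zq_pi k)
  (Zq_pi_is_zmod_morphism k).
HB.instance Definition _ k := GRing.isMonoidMorphism.Build _ _ (Zq_pi k)
  (Zq_pi_is_monoid_morphism k).

Lemma Zq_ind k (P : Zq_mod k -> Prop) :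
  (forall p, P (Zq_pi k p)) -> forall x, P x.
Proof. by move=> h x; rewrite -[x]Zq_reprK. Qed.

Definition Zq_proj (k : nat) (x : Zq_mod k.+1) : Zq_mod k :=
  Zq_pi k (Zq_repr x).

Lemma Zq_projE k p : Zq_proj (Zq_pi k.+1 p) = Zq_pi k p.
Proof.
rewrite /Zq_proj; have [r ->] := Zq_piE k.+1 p; apply/Zq_piP.
exists (r * (1 - 'X^(k.+2))); rewrite addrC addKr.
by rewrite {1}/qpoch big_nat_recr //= -mulrA [_ * (1 - _)]mulrC.
Qed.

Fact Zq_proj_is_zmod_morphism k : zmod_morphism (@Zq_proj k).
Proof.
elim/Zq_ind=> p; elim/Zq_ind=> p'.
by rewrite -rmorphB !Zq_projE rmorphB.
Qed.

Fact Zq_proj_is_monoid_morphism k : monoid_morphism (@Zq_proj k).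
Proof.
split; first by rewrite -(rmorph1 (Zq_pi k.+1)) Zq_projE rmorph1.
elim/Zq_ind=> p; elim/Zq_ind=> p'.
by rewrite -rmorphM !Zq_projE rmorphM.
Qed.

HB.instance Definition _ k := GRing.isZmodMorphism.Build _ _ (@Zq_proj k)
  (@Zq_proj_is_zmod_morphism k).
HB.instance Definition _ k := GRing.isMonoidMorphism.Build _ _ (@Zq_proj k)
  (@Zq_proj_is_monoid_morphism k).

(* The substitution q |-> q^n on Z[q]/((q)_{k+1}); it is well defined because
   (q)_m divides (q^n)_m (see [qpoch_compXn]). *)
Definition Zq_frob (n k : nat) (x : Zq_mod k) : Zq_mod k :=
  Zq_pi k (Zq_repr x \Po 'X^n).

Lemma qpoch_compXn n k : exists r, qpoch k \Po 'X^n = r * qpoch k.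
Proof.
elim: k => [|k [r IH]].
  by exists 1; rewrite /qpoch big_geq // rmorph1 mul1r.
have [s es] : exists s : {poly int}, 1 - 'X^(k.+1 * n) = s * (1 - 'X^(k.+1)).
  exists (\sum_(i < n) ('X^(k.+1)) ^+ i).
  by rewrite exprM -{1}(expr1n _ n) subrXX mulrC; congr (_ * _);
     apply: eq_bigr => i _; rewrite expr1n mul1r.
exists (r * s); rewrite /qpoch big_nat_recr //= -/(qpoch k) rmorphM /= IH.
rewrite rmorphB rmorph1 /= comp_Xn_poly -exprM [(n * _)%N]mulnC es.
by rewrite mulrACA.
Qed.

Lemma Zq_frobE n k p : Zq_frob n (Zq_pi k p) = Zq_pi k (p \Po 'X^n).
Proof.
rewrite /Zq_frob; have [r ->] := Zq_piE k p; apply/Zq_piP.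
have [s es] := qpoch_compXn n k.+1.
exists ((r \Po 'X^n) * s).
by rewrite rmorphD rmorphM /= addrC addKr es mulrA.
Qed.

Fact Zq_frob_is_zmod_morphism n k : zmod_morphism (@Zq_frob n k).
Proof.
elim/Zq_ind=> p; elim/Zq_ind=> p'.
by rewrite -[X in Zq_frob n X](rmorphB (Zq_pi k)) !Zq_frobE comp_polyB rmorphB.
Qed.

Fact Zq_frob_is_monoid_morphism n k : monoid_morphism (@Zq_frob n k).
Proof.
split; first by rewrite -(rmorph1 (Zq_pi k)) Zq_frobE -polyC1 comp_polyC.
elim/Zq_ind=> p; elim/Zq_ind=> p'.
by rewrite -[X in Zq_frob n X](rmorphM (Zq_pi k)) !Zq_frobE comp_polyM rmorphM.
Qed.

HB.instance Definition _ n k := GRing.isZmodMorphism.Build _ _ (@Zq_frob n k)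
  (@Zq_frob_is_zmod_morphism n k).
HB.instance Definition _ n k := GRing.isMonoidMorphism.Build _ _ (@Zq_frob n k)
  (@Zq_frob_is_monoid_morphism n k).

Lemma Zq_proj_frob n k (x : Zq_mod k.+1) :
  Zq_proj (Zq_frob n x) = Zq_frob n (Zq_proj x).
Proof. by elim/Zq_ind: x => p; rewrite Zq_frobE !Zq_projE Zq_frobE. Qed.

Record habiro := Habiro {
  habiro_at :> forall k, Zq_mod k;
  habiro_compat : forall k, Zq_proj (habiro_at k.+1) = habiro_at k
}.

Lemma habiroP (f g : habiro) : (forall k, f k = g k) -> f = g.
Proof.
case: f g => [f hf] [g hg] /= e.
have {}e : f = g by apply: functional_extensionality_dep.
by subst g; congr Habiro; apply: Prop_irrelevance.
Qed.

HB.instance Definition _ := gen_eqMixin habiro.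
HB.instance Definition _ := gen_choiceMixin habiro.

Local Obligation Tactic := idtac.

Program Definition habiro_zero := @Habiro (fun=> 0) _.
Next Obligation. by move=> k; apply: rmorph0. Qed.
Program Definition habiro_one := @Habiro (fun=> 1) _.
Next Obligation. by move=> k; apply: rmorph1. Qed.
Program Definition habiro_opp (f : habiro) := @Habiro (fun k => - f k) _.
Next Obligation. by move=> f k; rewrite rmorphN /= habiro_compat. Qed.
Program Definition habiro_add (f g : habiro) := @Habiro (fun k => f k + g k) _.
Next Obligation. by move=> f g k; rewrite /= rmorphD /= !habiro_compat. Qed.
Program Definition habiro_mul (f g : habiro) := @Habiro (fun k => f k * g k) _.
Next Obligation. by move=> f g k; rewrite /= rmorphM /= !habiro_compat. Qed.

Fact habiro_addA : associative habiro_add.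
Proof. by move=> f g h; apply: habiroP => k; apply: addrA. Qed.
Fact habiro_addC : commutative habiro_add.
Proof. by move=> f g; apply: habiroP => k; apply: addrC. Qed.
Fact habiro_add0 : left_id habiro_zero habiro_add.
Proof. by move=> f; apply: habiroP => k; apply: add0r. Qed.
Fact habiro_addN : left_inverse habiro_zero habiro_opp habiro_add.
Proof. by move=> f; apply: habiroP => k; apply: addNr. Qed.

HB.instance Definition _ := GRing.isZmodule.Build habiro
  habiro_addA habiro_addC habiro_add0 habiro_addN.

Fact habiro_mulA : associative habiro_mul.
Proof. by move=> f g h; apply: habiroP => k; apply: mulrA. Qed.
Fact habiro_mulC : commutative habiro_mul.
Proof. by move=> f g; apply: habiroP => k; apply: mulrC. Qed.
Fact habiro_mul1 : left_id habiro_one habiro_mul.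
Proof. by move=> f; apply: habiroP => k; apply: mul1r. Qed.
Fact habiro_mulDl : left_distributive habiro_mul +%R.
Proof. by move=> f g h; apply: habiroP => k; apply: mulrDl. Qed.
Fact habiro_one_neq0 : habiro_one != 0.
Proof.
apply/eqP => /(congr1 (fun f : habiro => f 0%N)) /eqP.
by rewrite /= oner_eq0.
Qed.

HB.instance Definition _ := GRing.Zmodule_isComNzRing.Build habiro
  habiro_mulA habiro_mulC habiro_mul1 habiro_mulDl habiro_one_neq0.

(* sigma_n(f)(q) = f(q^n) *)
Program Definition sigma (n : nat) (f : habiro) :=
  @Habiro (fun k => Zq_frob n (f k)) _.
Next Obligation. by move=> n f k; rewrite Zq_proj_frob habiro_compat. Qed.

Fact sigma_is_zmod_morphism n : zmod_morphism (sigma n).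
Proof. by move=> f g; apply: habiroP => k; rewrite /= rmorphB. Qed.

Fact sigma_is_monoid_morphism n : monoid_morphism (sigma n).
Proof.
by split=> [|f g]; apply: habiroP => k; rewrite /= (rmorph1, rmorphM).
Qed.

HB.instance Definition _ n := GRing.isZmodMorphism.Build _ _ (sigma n)
  (sigma_is_zmod_morphism n).
HB.instance Definition _ n := GRing.isMonoidMorphism.Build _ _ (sigma n)
  (sigma_is_monoid_morphism n).

Lemma sigma1 f : sigma 1 f = f.
Proof.
apply: habiroP => k /=; elim/Zq_ind: (f k) => p.
by rewrite Zq_frobE expr1 comp_polyXr.
Qed.

Lemma sigmaM n m f : sigma n (sigma m f) = sigma (n * m) f.
Proof.
apply: habiroP => k /=; elim/Zq_ind: (f k) => p.
by rewrite !Zq_frobE -comp_polyA comp_Xn_poly -exprM.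
Qed.

(* The pair (N, f) is the element f of the copy of the Habiro ring with
   index N. Two elements are identified when they have the same image in a
   copy whose index is a common multiple of both indices. *)
Definition dl_pre := (posint * habiro)%type.

Definition dl_equiv (x y : dl_pre) : bool :=
  `[< exists a b : posint,
        pmul a x.1 = pmul b y.1 /\ sigma a x.2 = sigma b y.2 >].

Lemma dl_equiv_class : equiv_class_of dl_equiv.
Proof.
split.
- by move=> x; apply/asboolP; exists pone, pone.
- move=> x y; apply/asboolP/asboolP => -[a [b [e1 e2]]]; exists b, a;
  by split.
- move=> y x z /asboolP[a [b [e1 e2]]] /asboolP[c [d [e3 e4]]].
  apply/asboolP; exists (pmul c a), (pmul b d); split.
    rewrite -pmulA e1 pmulA [pmul c b]pmulC -pmulA e3.
    by rewrite pmulA.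
  rewrite -[LHS]/(sigma (c * a) x.2) -[RHS]/(sigma (b * d) z.2).
  by rewrite -!sigmaM e2 -e4 !sigmaM mulnC.
Qed.

Canonical dl_equiv_rel := EquivRelPack dl_equiv_class.

Definition habiro_inf := {eq_quot dl_equiv}.

HB.instance Definition _ := Choice.on habiro_inf.
HB.instance Definition _ := EqQuotient.on habiro_inf.

Definition dl_in (N : posint) (f : habiro) : habiro_inf :=
  \pi_habiro_inf (N, f).

Lemma dl_inP N M f g : dl_in N f = dl_in M g <->
  exists a b : posint, pmul a N = pmul b M /\ sigma a f = sigma b g.
Proof.
split; first by move=> /eqmodP /asboolP.
by move=> h; apply/eqmodP/asboolP.
Qed.

Lemma dl_in_sigma k N f : dl_in (pmul k N) (sigma (k : posint) f) = dl_in N f.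
Proof.
apply/dl_inP; exists pone, k; split; first by rewrite pmul1n.
by rewrite sigma1.
Qed.

Lemma dl_ind (P : habiro_inf -> Prop) :
  (forall N f, P (dl_in N f)) -> forall x, P x.
Proof. by move=> h x; rewrite -[x]reprK; case: (repr x). Qed.

Lemma dl_ind2 (P : habiro_inf -> habiro_inf -> Prop) :
  (forall N f g, P (dl_in N f) (dl_in N g)) -> forall x y, P x y.
Proof.
move=> h x y; elim/dl_ind: x => N f; elim/dl_ind: y => M g.
by rewrite -(dl_in_sigma M N) -(dl_in_sigma N M) [pmul M N]pmulC.
Qed.

Lemma dl_ind3 (P : habiro_inf -> habiro_inf -> habiro_inf -> Prop) :
  (forall N f g h, P (dl_in N f) (dl_in N g) (dl_in N h)) ->
  forall x y z, P x y z.
Proof.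
move=> h x y z; move: x y; apply: dl_ind2 => N f g; elim/dl_ind: z => M k.
rewrite -(dl_in_sigma M N f) -(dl_in_sigma M N g) -(dl_in_sigma N M k).
by rewrite [pmul M N]pmulC.
Qed.

Definition dl_op2 (op : habiro -> habiro -> habiro) (x y : habiro_inf) :=
  let: (N, f) := repr x in let: (M, g) := repr y in
  dl_in (pmul N M) (op (sigma M f) (sigma N g)).

Definition dl_opp (x : habiro_inf) :=
  let: (N, f) := repr x in dl_in N (- f).

Definition dl_zero : habiro_inf := dl_in pone 0.
Definition dl_one : habiro_inf := dl_in pone 1.
Definition dl_add := dl_op2 +%R.
Definition dl_mul := dl_op2 *%R.

Lemma dl_repr N f : exists M g, repr (dl_in N f) = (M, g) /\
  exists a b : posint, pmul a M = pmul b N /\ sigma a g = sigma b f.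
Proof.
have := reprK (dl_in N f); case: (repr _) => M g e; exists M, g.
by split=> //; apply/dl_inP.
Qed.

Lemma dl_op2E op N f g :
  (forall n : nat, {morph sigma n : f g / op f g}) ->
  dl_op2 op (dl_in N f) (dl_in N g) = dl_in N (op f g).
Proof.
move=> opM; rewrite /dl_op2.
have [M [f' [-> [a [b [e1 e2]]]]]] := dl_repr N f.
have [K [g' [-> [c [d [e3 e4]]]]]] := dl_repr N g.
apply/dl_inP; exists (pmul a c), (pmul (pmul b d) N); split.
  rewrite [pmul M K]pmulC -pmulA [pmul c _]pmulA e3 -pmulA [pmul N M]pmulC.
  by rewrite !pmulA [pmul a d]pmulC -[pmul (pmul d a) M]pmulA e1 [pmul b d]pmulC !pmulA.
have {}e1 := congr1 nat_of_posint e1; have {}e3 := congr1 nat_of_posint e3.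
rewrite /= in e1 e3; rewrite /= !opM !sigmaM; congr (op _ _).
  have -> : (a * c * K = d * N * a)%N by rewrite -mulnA e3 mulnC.
  by rewrite -sigmaM e2 sigmaM mulnC mulnA.
have -> : (a * c * M = b * N * c)%N by rewrite mulnAC e1.
by rewrite -sigmaM e4 sigmaM mulnAC.
Qed.

Lemma dl_addE N f g : dl_add (dl_in N f) (dl_in N g) = dl_in N (f + g).
Proof. by apply: dl_op2E => n u v; apply: rmorphD. Qed.

Lemma dl_mulE N f g : dl_mul (dl_in N f) (dl_in N g) = dl_in N (f * g).
Proof. by apply: dl_op2E => n u v; apply: rmorphM. Qed.

Lemma dl_oppE N f : dl_opp (dl_in N f) = dl_in N (- f).
Proof.
rewrite /dl_opp; have [M [g [-> [a [b [e1 e2]]]]]] := dl_repr N f.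
by apply/dl_inP; exists a, b; rewrite !rmorphN /= e2.
Qed.

Lemma dl_zeroE N : dl_zero = dl_in N 0.
Proof. by rewrite /dl_zero -(dl_in_sigma N pone) rmorph0 pmuln1. Qed.

Lemma dl_oneE N : dl_one = dl_in N 1.
Proof. by rewrite /dl_one -(dl_in_sigma N pone) rmorph1 pmuln1. Qed.

Fact dl_addA : associative dl_add.
Proof. by apply: dl_ind3 => N f g h; rewrite !dl_addE addrA. Qed.
Fact dl_addC : commutative dl_add.
Proof. by apply: dl_ind2 => N f g; rewrite !dl_addE addrC. Qed.
Fact dl_add0 : left_id dl_zero dl_add.
Proof. by elim/dl_ind=> N f; rewrite (dl_zeroE N) dl_addE add0r. Qed.
Fact dl_addN : left_inverse dl_zero dl_opp dl_add.
Proof. by elim/dl_ind=> N f; rewrite dl_oppE dl_addE addNr (dl_zeroE N). Qed.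

HB.instance Definition _ := GRing.isZmodule.Build habiro_inf
  dl_addA dl_addC dl_add0 dl_addN.

Fact dl_mulA : associative dl_mul.
Proof. by apply: dl_ind3 => N f g h; rewrite !dl_mulE mulrA. Qed.
Fact dl_mulC : commutative dl_mul.
Proof. by apply: dl_ind2 => N f g; rewrite !dl_mulE mulrC. Qed.
Fact dl_mul1 : left_id dl_one dl_mul.
Proof. by elim/dl_ind=> N f; rewrite (dl_oneE N) dl_mulE mul1r. Qed.
Fact dl_mulDl : left_distributive dl_mul +%R.
Proof.
apply: dl_ind3 => N f g h.
by rewrite -[_ + _]/(dl_add _ _) -[RHS]/(dl_add _ _) !(dl_addE, dl_mulE) mulrDl.
Qed.
Fact dl_one_neq0 : dl_one != 0.
Proof.
apply/eqP => /dl_inP[a [b [_ /eqP]]].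
by rewrite rmorph1 rmorph0 oner_eq0.
Qed.

HB.instance Definition _ := GRing.Zmodule_isComNzRing.Build habiro_inf
  dl_mulA dl_mulC dl_mul1 dl_mulDl dl_one_neq0.

Lemma dl_inD N f g : dl_in N (f + g) = dl_in N f + dl_in N g.
Proof. by rewrite -dl_addE. Qed.

Fact dl_in_is_zmod_morphism N : zmod_morphism (dl_in N).
Proof. by move=> f g; rewrite dl_inD -dl_oppE. Qed.

Fact dl_in_is_monoid_morphism N : monoid_morphism (dl_in N).
Proof. by split=> [|f g]; rewrite -?dl_oneE // -dl_mulE. Qed.

HB.instance Definition _ N := GRing.isZmodMorphism.Build _ _ (dl_in N)
  (dl_in_is_zmod_morphism N).
HB.instance Definition _ N := GRing.isMonoidMorphism.Build _ _ (dl_in N)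
  (dl_in_is_monoid_morphism N).

Definition sigma_inf (n : posint) (x : habiro_inf) : habiro_inf :=
  let: (N, f) := repr x in dl_in N (sigma n f).

Lemma sigma_infE n N f : sigma_inf n (dl_in N f) = dl_in N (sigma n f).
Proof.
rewrite /sigma_inf; have [M [g [-> [a [b [e1 e2]]]]]] := dl_repr N f.
apply/dl_inP; exists a, b; split=> //.
by rewrite !sigmaM mulnC -sigmaM e2 sigmaM mulnC.
Qed.

(* rho_n(a) = mu_n a mu_n^* maps mu_N f mu_N^* to mu_{nN} f mu_{nN}^*. *)
Definition rho_inf (n : posint) (x : habiro_inf) : habiro_inf :=
  let: (N, f) := repr x in dl_in (pmul n N) f.

Lemma rho_infE n N f : rho_inf n (dl_in N f) = dl_in (pmul n N) f.
Proof.
rewrite /rho_inf; have [M [g [-> [a [b [e1 e2]]]]]] := dl_repr N f.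
apply/dl_inP; exists a, b; split=> //.
by rewrite pmulA [pmul a n]pmulC -pmulA e1 !pmulA [pmul n b]pmulC.
Qed.

Lemma sigma_infK n : cancel (sigma_inf n) (rho_inf n).
Proof. by elim/dl_ind=> N f; rewrite sigma_infE rho_infE dl_in_sigma. Qed.

Lemma rho_infK n : cancel (rho_inf n) (sigma_inf n).
Proof. by elim/dl_ind=> N f; rewrite rho_infE sigma_infE dl_in_sigma. Qed.

Fact sigma_inf_is_zmod_morphism n : zmod_morphism (sigma_inf n).
Proof. by apply: dl_ind2 => N f g; rewrite -rmorphB !sigma_infE !rmorphB. Qed.

Fact sigma_inf_is_monoid_morphism n : monoid_morphism (sigma_inf n).
Proof.
split; first by rewrite -(rmorph1 (dl_in pone)) sigma_infE !rmorph1.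
by apply: dl_ind2 => N f g; rewrite -rmorphM !sigma_infE !rmorphM.
Qed.

Fact rho_inf_is_zmod_morphism n : zmod_morphism (rho_inf n).
Proof. by apply: dl_ind2 => N f g; rewrite -rmorphB !rho_infE !rmorphB. Qed.

Fact rho_inf_is_monoid_morphism n : monoid_morphism (rho_inf n).
Proof.
split; first by rewrite -(rmorph1 (dl_in pone)) rho_infE !rmorph1.
by apply: dl_ind2 => N f g; rewrite -rmorphM !rho_infE !rmorphM.
Qed.

HB.instance Definition _ n := GRing.isZmodMorphism.Build _ _ (sigma_inf n)
  (sigma_inf_is_zmod_morphism n).
HB.instance Definition _ n := GRing.isMonoidMorphism.Build _ _ (sigma_inf n)
  (sigma_inf_is_monoid_morphism n).
HB.instance Definition _ n := GRing.isZmodMorphism.Build _ _ (rho_inf n)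
  (rho_inf_is_zmod_morphism n).
HB.instance Definition _ n := GRing.isMonoidMorphism.Build _ _ (rho_inf n)
  (rho_inf_is_monoid_morphism n).

(* An action of a group by ring endomorphisms that is unital and
   multiplicative is an action by automorphisms. *)
Record ring_action (G : groupType) (R : pzRingType) := RingAction {
  act :> G -> {rmorphism R -> R};
  act1 : forall a, act 1%g a = a;
  actM : forall g h a, act (g * h)%g a = act g (act h a)
}.

(* The crossed product: finite formal sums of terms << a *g g >>, which
   stand for a u_g, with (a u_g) (b u_h) = a (g.b) u_{gh}. *)
Definition crossed (G : groupType) (R : pzRingType) (alpha : ring_action G R) :=
  {malg R[G]}.

Section CrossedProduct.
Variables (G : groupType) (R : pzRingType) (alpha : ring_action G R).

Implicit Types (x y z : crossed alpha) (a b : R) (g h : G).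

HB.instance Definition _ := GRing.Zmodule.on (crossed alpha).

Definition cp_one : crossed alpha := << 1 *g 1%g >>.

Definition cp_mul x y : crossed alpha :=
  \sum_(g <- msupp x) \sum_(h <- msupp y)
    << x@_g * alpha g y@_h *g (g * h)%g >>.

Local Open Scope fset_scope.
Local Open Scope ring_scope.

Lemma cp_mulw (d1 d2 : {fset G}) x y :
  msupp x `<=` d1 -> msupp y `<=` d2 ->
  cp_mul x y = \sum_(g <- d1) \sum_(h <- d2)
    << x@_g * alpha g y@_h *g (g * h)%g >>.
Proof.
move=> le1 le2; rewrite /cp_mul (big_fset_incl _ le1) /=.
  apply/eq_bigr=> k1 _; apply/big_fset_incl => // k _ /mcoeff_outdom ->.
  by rewrite rmorph0 mulr0 monalgU0.
move=> k _ /mcoeff_outdom xk.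
by rewrite big1 // => k' _; rewrite xk mul0r monalgU0.
Qed.

Lemma cp_mulUU a b g h :
  cp_mul << a *g g >> << b *g h >> = << a * alpha g b *g (g * h)%g >>.
Proof. by rewrite (cp_mulw msuppU_le msuppU_le) !big_seq_fset1 !mcoeffUU. Qed.

Fact cp_mulDl : left_distributive cp_mul +%R.
Proof.
move=> x y z.
rewrite [in RHS](cp_mulw (fsubsetUl _ (msupp y)) (fsubset_refl _)).
rewrite [in RHS](cp_mulw (fsubsetUr (msupp x) _) (fsubset_refl _)).
rewrite (cp_mulw (msuppD_le _ _) (fsubset_refl _)).
rewrite -big_split /=; apply/eq_bigr=> k1 _.
rewrite -big_split /=; apply/eq_bigr=> k2 _.
by rewrite mcoeffD mulrDl monalgUD.
Qed.

Fact cp_mulDr : right_distributive cp_mul +%R.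
Proof.
move=> z x y.
rewrite [in RHS](cp_mulw (fsubset_refl _) (fsubsetUl _ (msupp y))).
rewrite [in RHS](cp_mulw (fsubset_refl _) (fsubsetUr (msupp x) _)).
rewrite (cp_mulw (fsubset_refl _) (msuppD_le _ _)).
rewrite -big_split /=; apply/eq_bigr=> k1 _.
rewrite -big_split /=; apply/eq_bigr=> k2 _.
by rewrite mcoeffD rmorphD mulrDr monalgUD.
Qed.

Lemma cp_mul0x : left_zero 0 cp_mul.
Proof. by move=> x; rewrite /cp_mul msupp0 big_seq_fset0. Qed.

Lemma cp_mulx0 : right_zero 0 cp_mul.
Proof.
by move=> x; rewrite /cp_mul big1 // => k _; rewrite msupp0 big_seq_fset0.
Qed.

Lemma crossed_ind (P : crossed alpha -> Prop) :
  P 0 -> (forall x y, P x -> P y -> P (x + y)) ->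
  (forall a g, P << a *g g >>) -> forall x, P x.
Proof.
by move=> P0 PD PU x; rewrite [x]monalgE; elim/big_ind: _ => // *; apply: PU.
Qed.

Fact cp_mulA : associative cp_mul.
Proof.
move=> x y z; elim/crossed_ind: x => [|x x' Ex Ex'|a g].
- by rewrite !cp_mul0x.
- by rewrite !cp_mulDl Ex Ex'.
elim/crossed_ind: y => [|y y' Ey Ey'|b h].
- by rewrite cp_mulx0 !cp_mul0x cp_mulx0.
- by rewrite !(cp_mulDl, cp_mulDr) Ey Ey'.
elim/crossed_ind: z => [|z z' Ez Ez'|c k].
- by rewrite !cp_mulx0.
- by rewrite !cp_mulDr Ez Ez'.
by rewrite !cp_mulUU rmorphM -actM !mulrA mulgA.
Qed.

Fact cp_mul1x : left_id cp_one cp_mul.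
Proof.
elim/crossed_ind=> [|x y Ex Ey|a g]; first exact: cp_mulx0.
  by rewrite cp_mulDr Ex Ey.
by rewrite cp_mulUU act1 mul1r mul1g.
Qed.

Fact cp_mulx1 : right_id cp_one cp_mul.
Proof.
elim/crossed_ind=> [|x y Ex Ey|a g]; first exact: cp_mul0x.
  by rewrite cp_mulDl Ex Ey.
by rewrite cp_mulUU rmorph1 mulr1 mulg1.
Qed.

HB.instance Definition _ := GRing.Zmodule_isPzRing.Build (crossed alpha)
  cp_mulA cp_mul1x cp_mulx1 cp_mulDl cp_mulDr.

Definition cp_coef (a : R) : crossed alpha := << a *g 1%g >>.
Definition cp_unit (g : G) : crossed alpha := << 1 *g g >>.

End CrossedProduct.

Arguments cp_coef {G R} alpha a.
Arguments cp_unit {G R} alpha g.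

(* rho_{m/n} = rho_m o sigma_n for m/n in lowest terms *)
Definition rho_fun (r : posrat) : {rmorphism habiro_inf -> habiro_inf} :=
  rho_inf (posrat_num r) \o sigma_inf (posrat_den r).

Lemma rho_sigma (m n m' n' : posint) x :
  (m * n' = m' * n)%N ->
  rho_inf m (sigma_inf n x) = rho_inf m' (sigma_inf n' x).
Proof.
move=> e; elim/dl_ind: x => N f; rewrite !sigma_infE !rho_infE.
apply/dl_inP; exists n', n; split.
  by rewrite !pmulA; congr pmul; apply: posint_inj; rewrite /= mulnC e mulnC.
by rewrite !sigmaM mulnC.
Qed.

Fact rho_act1 x : rho_fun 1%g x = x.
Proof.
have e : posrat_num 1%g = posrat_den 1%g by apply: posint_inj.
by rewrite /rho_fun /= e sigma_infK.
Qed.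

Fact rho_actM (r s : posrat) x : rho_fun (r * s)%g x = rho_fun r (rho_fun s x).
Proof.
rewrite /rho_fun /=.
set m := posrat_num r; set n := posrat_den r.
set m' := posrat_num s; set n' := posrat_den s.
transitivity (rho_inf (pmul m m') (sigma_inf (pmul n n') x)).
  apply: rho_sigma; apply/eqP; rewrite -(eqr_nat rat) !natrM.
  have nz (k : posint) : (k : nat)%:R != 0 :> rat.
    by rewrite pnatr_eq0 -lt0n posint_gt0.
  have := posrat_frac (r * s)%g.
  rewrite -[val _]/(val r * val s) (posrat_frac r) (posrat_frac s).
  rewrite -/m -/n -/m' -/n' mulf_div => /eqP.
  by rewrite eqr_div ?mulf_neq0 // eq_sym.
elim/dl_ind: x => N f; rewrite !(sigma_infE, rho_infE) -sigmaM -pmulA.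
by [].
Qed.

Definition rho_action : ring_action posrat habiro_inf :=
  RingAction rho_act1 rho_actM.

Inductive ring_expr (X : Type) : Type :=
| EGen of X
| EZero
| EOne
| EOpp of ring_expr X
| EAdd of ring_expr X & ring_expr X
| EMul of ring_expr X & ring_expr X.

Arguments EZero {X}.
Arguments EOne {X}.

Section Presentation.
Variables (X : Type) (rel : ring_expr X -> ring_expr X -> Prop).

(* The least congruence that contains the relations and makes the
   expressions into an associative unital ring *)
Inductive ring_cong : ring_expr X -> ring_expr X -> Prop :=
| cong_rel e f : rel e f -> ring_cong e f
| cong_refl e : ring_cong e e
| cong_sym e f : ring_cong e f -> ring_cong f e
| cong_trans e f g : ring_cong e f -> ring_cong f g -> ring_cong e g
| cong_opp e e' : ring_cong e e' -> ring_cong (EOpp e) (EOpp e')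
| cong_add e e' f f' : ring_cong e e' -> ring_cong f f' ->
    ring_cong (EAdd e f) (EAdd e' f')
| cong_mul e e' f f' : ring_cong e e' -> ring_cong f f' ->
    ring_cong (EMul e f) (EMul e' f')
| cong_addA e f g : ring_cong (EAdd e (EAdd f g)) (EAdd (EAdd e f) g)
| cong_addC e f : ring_cong (EAdd e f) (EAdd f e)
| cong_add0 e : ring_cong (EAdd EZero e) e
| cong_addN e : ring_cong (EAdd (EOpp e) e) EZero
| cong_mulA e f g : ring_cong (EMul e (EMul f g)) (EMul (EMul e f) g)
| cong_mul1l e : ring_cong (EMul EOne e) e
| cong_mul1r e : ring_cong (EMul e EOne) e
| cong_mulDl e f g :
    ring_cong (EMul (EAdd e f) g) (EAdd (EMul e g) (EMul f g))
| cong_mulDr e f g :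
    ring_cong (EMul e (EAdd f g)) (EAdd (EMul e f) (EMul e g)).

HB.instance Definition _ := gen_eqMixin (ring_expr X).
HB.instance Definition _ := gen_choiceMixin (ring_expr X).

Definition ring_congb (e f : ring_expr X) : bool := `[< ring_cong e f >].

Lemma ring_congb_class : equiv_class_of ring_congb.
Proof.
split.
- by move=> e; apply/asboolP; apply: cong_refl.
- by move=> e f; apply/asboolP/asboolP; apply: cong_sym.
- by move=> f e g /asboolP ef /asboolP fg; apply/asboolP; apply: cong_trans fg.
Qed.

Canonical ring_congb_rel := EquivRelPack ring_congb_class.

Definition presented := {eq_quot ring_congb}.

HB.instance Definition _ := Choice.on presented.
HB.instance Definition _ := EqQuotient.on presented.

Definition pr_class (e : ring_expr X) : presented := \pi_presented e.

Lemma pr_classP e f : pr_class e = pr_class f <-> ring_cong e f.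
Proof.
split; first by move=> /eqmodP /asboolP.
by move=> h; apply/eqmodP/asboolP.
Qed.

Lemma pr_reprK x : pr_class (repr x) = x. Proof. exact: reprK. Qed.

Lemma pr_repr e : ring_cong (repr (pr_class e)) e.
Proof. by apply/pr_classP; rewrite pr_reprK. Qed.

Lemma pr_ind (P : presented -> Prop) :
  (forall e, P (pr_class e)) -> forall x, P x.
Proof. by move=> h x; rewrite -[x]pr_reprK. Qed.

Definition pr_zero : presented := pr_class EZero.
Definition pr_one : presented := pr_class EOne.
Definition pr_opp (x : presented) := pr_class (EOpp (repr x)).
Definition pr_add (x y : presented) := pr_class (EAdd (repr x) (repr y)).
Definition pr_mul (x y : presented) := pr_class (EMul (repr x) (repr y)).

Lemma pr_oppE e : pr_opp (pr_class e) = pr_class (EOpp e).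
Proof. by apply/pr_classP/cong_opp/pr_repr. Qed.

Lemma pr_addE e f : pr_add (pr_class e) (pr_class f) = pr_class (EAdd e f).
Proof. by apply/pr_classP/cong_add; apply: pr_repr. Qed.

Lemma pr_mulE e f : pr_mul (pr_class e) (pr_class f) = pr_class (EMul e f).
Proof. by apply/pr_classP/cong_mul; apply: pr_repr. Qed.

Fact pr_addA : associative pr_add.
Proof.
elim/pr_ind=> e; elim/pr_ind=> f; elim/pr_ind=> g.
by rewrite !pr_addE; apply/pr_classP/cong_addA.
Qed.

Fact pr_addC : commutative pr_add.
Proof.
elim/pr_ind=> e; elim/pr_ind=> f.
by rewrite !pr_addE; apply/pr_classP/cong_addC.
Qed.

Fact pr_add0 : left_id pr_zero pr_add.
Proof. by elim/pr_ind=> e; rewrite pr_addE; apply/pr_classP/cong_add0. Qed.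

Fact pr_addN : left_inverse pr_zero pr_opp pr_add.
Proof.
by elim/pr_ind=> e; rewrite pr_oppE pr_addE; apply/pr_classP/cong_addN.
Qed.

HB.instance Definition _ := GRing.isZmodule.Build presented
  pr_addA pr_addC pr_add0 pr_addN.

Fact pr_mulA : associative pr_mul.
Proof.
elim/pr_ind=> e; elim/pr_ind=> f; elim/pr_ind=> g.
by rewrite !pr_mulE; apply/pr_classP/cong_mulA.
Qed.

Fact pr_mul1l : left_id pr_one pr_mul.
Proof. by elim/pr_ind=> e; rewrite pr_mulE; apply/pr_classP/cong_mul1l. Qed.

Fact pr_mul1r : right_id pr_one pr_mul.
Proof. by elim/pr_ind=> e; rewrite pr_mulE; apply/pr_classP/cong_mul1r. Qed.

Fact pr_mulDl : left_distributive pr_mul +%R.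
Proof.
elim/pr_ind=> e; elim/pr_ind=> f; elim/pr_ind=> g.
rewrite -[_ + _]/(pr_add _ _) -[RHS]/(pr_add _ _) !(pr_mulE, pr_addE).
exact/pr_classP/cong_mulDl.
Qed.

Fact pr_mulDr : right_distributive pr_mul +%R.
Proof.
elim/pr_ind=> e; elim/pr_ind=> f; elim/pr_ind=> g.
rewrite -[_ + _]/(pr_add _ _) -[RHS]/(pr_add _ _) !(pr_mulE, pr_addE).
exact/pr_classP/cong_mulDr.
Qed.

HB.instance Definition _ := GRing.Zmodule_isPzRing.Build presented
  pr_mulA pr_mul1l pr_mul1r pr_mulDl pr_mulDr.

Definition pr_gen (x : X) : presented := pr_class (EGen x).

End Presentation.

Inductive mu_symbol : Type :=
| Mu of posint
| MuStar of posint.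

(* Only the symbols mu_n and mu_n^* carry an adjoint; no adjoint of elements of
   the Habiro ring is involved. *)
Definition mu_adj (s : mu_symbol) : mu_symbol :=
  match s with Mu n => MuStar n | MuStar n => Mu n end.

Inductive A_gen : Type :=
| GenH of habiro
| GenMu of mu_symbol.

Local Notation eH f := (EGen (GenH f)).
Local Notation eM s := (EGen (GenMu s)).
Local Notation "x ** y" := (EMul x y) (at level 40, left associativity).

(* The first three families say that the Habiro ring, with its own ring
   structure, maps to the ring A. In A the element of the direct limit
   represented by f in the copy with index N is mu_N f mu_N^*; the last
   family says that this only depends on that element, so that the direct
   limit maps to A and contains mu_N mu_N^* as the image of its element
   [dl_in N 1]. *)
Inductive A_rel : ring_expr A_gen -> ring_expr A_gen -> Prop :=
| rel_H1 : A_rel (eH 1) EOne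
| rel_HD f g : A_rel (eH (f + g)) (EAdd (eH f) (eH g))
| rel_HM f g : A_rel (eH (f * g)) (eH f ** eH g)
| rel_star n : A_rel (eM (mu_adj (MuStar n))) (eM (Mu n))
| rel_mul n m : A_rel (eM (Mu n) ** eM (Mu m)) (eM (Mu (pmul n m)))
| rel_coprime (n m : posint) : coprime n m ->
    A_rel (eM (Mu n) ** eM (MuStar m)) (eM (MuStar m) ** eM (Mu n))
| rel_isom n : A_rel (eM (MuStar n) ** eM (Mu n)) EOne
| rel_mu_sigma (n : posint) f :
    A_rel (eM (Mu n) ** eH (sigma n f)) (eH f ** eM (Mu n))
| rel_sigma_mu (n : posint) f :
    A_rel (eM (MuStar n) ** eH f) (eH (sigma n f) ** eM (MuStar n))
| rel_dirlim N M f g : dl_in N f = dl_in M g ->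
    A_rel (eM (Mu N) ** eH f ** eM (MuStar N))
          (eM (Mu M) ** eH g ** eM (MuStar M)).

Definition A_Zq := presented A_rel.

HB.instance Definition _ := GRing.PzRing.on A_Zq.

Definition A_H (f : habiro) : A_Zq := pr_gen A_rel (GenH f).
Definition A_mu (n : posint) : A_Zq := pr_gen A_rel (GenMu (Mu n)).
Definition A_mus (n : posint) : A_Zq := pr_gen A_rel (GenMu (MuStar n)).

(* Main.v *)
From HB Require Import structures.
Require Import Defs.
From mathcomp Require Import all_boot all_order all_algebra.
From mathcomp Require Import finmap monalg.

Set Implicit Arguments.
Unset Strict Implicit.
Unset Printing Implicit Defensive.

Import GRing.Theory Num.Theory.

Local Open Scope ring_scope.

(** The theorem compares two universal properties. A ring morphism out of a
    presented ring is an assignment of the generators that satisfies the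
    relations ([presented_lift]); a ring morphism out of a crossed product is
    a covariant pair, that is, a ring morphism [iota] on the coefficients and
    a multiplicative map [U] on the group with
    [U g * iota a = iota (g.a) * U g] ([crossed_lift]).

    In one direction, the crossed product satisfies the relations of the
    presentation, with [mu_n] sent to the group element [n] and [mu_n^*] to
    its inverse ([crossed_sound]).

    In the other direction, everything rests on the fact that [mu_n] is
    invertible in the presented ring, with inverse [mu_n^*] ([A_mu_mus]).
    Indeed [mu_n mu_n^*] is the image of the element of the direct limit
    represented by [1] in the copy with index [n]. This element is the unit of
    the direct limit, so [mu_n mu_n^* = mu_1 mu_1^*], and [mu_1] is an
    idempotent with a left inverse, hence [1]. It follows that
    [m/n |-> mu_m mu_n^*] is a well-defined multiplicative map on the positive
    rationals ([A_fracM]), and that [mu_N f mu_N^*] depends multiplicatively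
    on the element of the direct limit represented by [(N, f)]
    ([A_dl_is_monoid_morphism]). These two maps form a covariant pair
    ([A_frac_dl]).

    The two morphisms so obtained are inverse to each other because both
    composites fix generators. *)

(** * Universal property of a presented ring *)

Section PresentedLift.
Variables (X : Type) (rel : ring_expr X -> ring_expr X -> Prop).
Variable T : pzRingType.

(** The value in [T] of a formal ring expression, for the values [v] of its
    generators. *)
Fixpoint ring_eval (v : X -> T) (e : ring_expr X) : T :=
  match e with
  | EGen x => v x
  | EZero => 0
  | EOne => 1
  | EOpp e => - ring_eval v e
  | EAdd e f => ring_eval v e + ring_eval v f
  | EMul e f => ring_eval v e * ring_eval v f
  end.

Lemma ring_eval_cong (v : X -> T) :
  (forall e f, rel e f -> ring_eval v e = ring_eval v f) ->
  forall e f, ring_cong rel e f -> ring_eval v e = ring_eval v f.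
Proof.
move=> sound e f; elim=> //=.
- by move=> ? ? ? _ -> _ ->.
- by move=> ? ? _ ->.
- by move=> ? ? ? ? _ -> _ ->.
- by move=> ? ? ? ? _ -> _ ->.
- by move=> *; rewrite addrA.
- by move=> *; rewrite addrC.
- by move=> *; rewrite add0r.
- by move=> *; rewrite addNr.
- by move=> *; rewrite mulrA.
- by move=> *; rewrite mul1r.
- by move=> *; rewrite mulr1.
- by move=> *; rewrite mulrDl.
- by move=> *; rewrite mulrDr.
Qed.

Lemma presented_lift (v : X -> T) :
  (forall e f, rel e f -> ring_eval v e = ring_eval v f) ->
  exists phi : {rmorphism presented rel -> T},
    forall x, phi (pr_gen rel x) = v x.
Proof.
move=> sound; pose phi (x : presented rel) : T := ring_eval v (repr x).
have phiE e : phi (pr_class rel e) = ring_eval v e.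
  by apply: ring_eval_cong sound _ _ _; apply: pr_repr.
have phiB : zmod_morphism phi.
  elim/pr_ind=> e; elim/pr_ind=> f.
  rewrite -[_ - _]/(pr_add (pr_class rel e) (pr_opp (pr_class rel f))).
  by rewrite pr_oppE pr_addE !phiE.
have phiM : monoid_morphism phi.
  split; first exact: (phiE EOne).
  elim/pr_ind=> e; elim/pr_ind=> f.
  by rewrite -[_ * _]/(pr_mul (pr_class rel e) (pr_class rel f)) pr_mulE !phiE.
pose Phi : {rmorphism presented rel -> T} :=
  HB.pack phi (GRing.isZmodMorphism.Build _ _ phi phiB)
              (GRing.isMonoidMorphism.Build _ _ phi phiM).
by exists Phi => x; apply: (phiE (EGen x)).
Qed.

Lemma presented_morph_ext (phi psi : {rmorphism presented rel -> T}) :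
  (forall x, phi (pr_gen rel x) = psi (pr_gen rel x)) -> phi =1 psi.
Proof.
move=> eq_gen; elim/pr_ind; elim=> [x|||e IH|e IHe f IHf|e IHe f IHf].
- exact: eq_gen.
- by rewrite -[pr_class _ _]/(0 : presented rel) !rmorph0.
- by rewrite -[pr_class _ _]/(1 : presented rel) !rmorph1.
- rewrite -pr_oppE -[pr_opp _]/(- (pr_class rel e : presented rel)).
  by rewrite !rmorphN IH.
- rewrite -pr_addE -[pr_add _ _]/((pr_class rel e : presented rel) + pr_class rel f).
  by rewrite !rmorphD IHe IHf.
- rewrite -pr_mulE -[pr_mul _ _]/((pr_class rel e : presented rel) * pr_class rel f).
  by rewrite !rmorphM IHe IHf.
Qed.

End PresentedLift.

(** * Universal property of a crossed product *)

Section CrossedLift.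
Variables (G : groupType) (R : pzRingType) (alpha : ring_action G R).

Lemma cp_mulE a b g h :
  (<< a *g g >> : crossed alpha) * (<< b *g h >> : crossed alpha)
    = << a * alpha g b *g (g * h)%g >>.
Proof. exact: cp_mulUU. Qed.

Lemma cp_coef1 : cp_coef alpha 1 = 1.
Proof. by []. Qed.

Lemma cp_coefD a b : cp_coef alpha (a + b) = cp_coef alpha a + cp_coef alpha b.
Proof. exact: monalgUD. Qed.

Lemma cp_coefM a b : cp_coef alpha (a * b) = cp_coef alpha a * cp_coef alpha b.
Proof. by rewrite /cp_coef cp_mulE act1 mulg1. Qed.

Lemma cp_unit1 : cp_unit alpha 1%g = 1.
Proof. by []. Qed.

Lemma cp_unitM g h : cp_unit alpha (g * h)%g = cp_unit alpha g * cp_unit alpha h.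
Proof. by rewrite /cp_unit cp_mulE rmorph1 mulr1. Qed.

Lemma cp_unit_coef g a :
  cp_unit alpha g * cp_coef alpha a = cp_coef alpha (alpha g a) * cp_unit alpha g.
Proof. by rewrite /cp_unit /cp_coef !cp_mulE act1 mul1r mulr1 mulg1 mul1g. Qed.

Lemma cp_coef_conj g a :
  cp_unit alpha g * cp_coef alpha a * cp_unit alpha g^-1%g
    = cp_coef alpha (alpha g a).
Proof. by rewrite cp_unit_coef -mulrA -cp_unitM mulgV cp_unit1 mulr1. Qed.

Lemma cp_coef_unit a g : cp_coef alpha a * cp_unit alpha g = << a *g g >>.
Proof. by rewrite /cp_unit /cp_coef cp_mulE act1 mulr1 mul1g. Qed.

(** The values of [psi] on the monomials are those forced by
    [<< a *g g >> = a u_g]; covariance is what makes their linear extension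
    multiplicative. *)
Lemma crossed_lift (T : pzRingType) (iota : {rmorphism R -> T}) (U : G -> T) :
  U 1%g = 1 -> (forall g h, U (g * h)%g = U g * U h) ->
  (forall g a, U g * iota a = iota (alpha g a) * U g) ->
  exists psi : {rmorphism crossed alpha -> T},
    forall a g, psi << a *g g >> = iota a * U g.
Proof.
move=> U1 UM Ucov.
pose psi (x : crossed alpha) : T := \sum_(g <- msupp x) iota x@_g * U g.
have psiw (d : {fset G}) x : (msupp x `<=` d)%fset ->
    psi x = \sum_(g <- d) iota x@_g * U g.
  move=> le; rewrite /psi (big_fset_incl _ le) //= => g _ /mcoeff_outdom ->.
  by rewrite rmorph0 mul0r.
have psiU a g : psi << a *g g >> = iota a * U g.
  by rewrite (psiw _ _ msuppU_le) big_seq_fset1 mcoeffUU.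
have psiB : zmod_morphism psi.
  move=> x y.
  rewrite (psiw _ _ (fsubsetUl (msupp x) (msupp y))).
  rewrite (psiw _ _ (fsubsetUr (msupp x) (msupp y))).
  rewrite (psiw _ _ (msuppB_le x y)) -sumrB.
  by apply: eq_bigr => g _; rewrite mcoeffB rmorphB mulrBl.
have psi0 : psi 0 = 0 by rewrite -(subrr 0) psiB subrr.
have psiD x y : psi (x + y) = psi x + psi y.
  by rewrite -{1}[y]opprK psiB -(sub0r y) psiB psi0 sub0r opprK.
have psiM : monoid_morphism psi.
  split; first by rewrite -[1]/(cp_one alpha) psiU rmorph1 mul1r.
  move=> x y; elim/crossed_ind: x => [|x x' Ex Ex'|a g].
  - by rewrite mul0r psi0 mul0r.
  - by rewrite mulrDl !psiD Ex Ex' mulrDl.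
  elim/crossed_ind: y => [|y y' Ey Ey'|b h].
  - by rewrite mulr0 psi0 mulr0.
  - by rewrite mulrDr !psiD Ey Ey' mulrDr.
  by rewrite cp_mulE !psiU rmorphM UM -!mulrA [U g * (_ * _)]mulrA Ucov !mulrA.
pose Psi : {rmorphism crossed alpha -> T} :=
  HB.pack psi (GRing.isZmodMorphism.Build _ _ psi psiB)
              (GRing.isMonoidMorphism.Build _ _ psi psiM).
by exists Psi.
Qed.

Lemma crossed_morph_ext (T : pzRingType)
    (phi psi : {rmorphism crossed alpha -> T}) :
  (forall a g, phi << a *g g >> = psi << a *g g >>) -> phi =1 psi.
Proof.
move=> eqU; elim/crossed_ind => [|x y Ex Ey|a g]; last exact: eqU.
  by rewrite !rmorph0.
by rewrite !rmorphD Ex Ey.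
Qed.

End CrossedLift.

(** * The relations hold in the crossed product *)

Lemma posrat_mulgC (r s : posrat) : (r * s = s * r)%g.
Proof. by apply: val_inj; apply: mulrC. Qed.

Lemma posrat_ofM n m : posrat_of (pmul n m) = (posrat_of n * posrat_of m)%g.
Proof. by apply: val_inj; rewrite /= natrM. Qed.

Lemma posrat_fracE (r : posrat) :
  r = (posrat_of (posrat_num r) * (posrat_of (posrat_den r))^-1)%g.
Proof. by apply: val_inj; rewrite [LHS]posrat_frac. Qed.

Lemma posrat_frac_cross (r : posrat) (m n : posint) :
  r = (posrat_of m * (posrat_of n)^-1)%g ->
  (posrat_num r * n = m * posrat_den r)%N.
Proof.
have nz (k : posint) : (k : nat)%:R != 0 :> rat.
  by rewrite pnatr_eq0 -lt0n posint_gt0.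
move=> /(congr1 val); rewrite posrat_frac -[RHS]/(m%:R / n%:R) => /eqP.
by rewrite eqr_div // -!natrM eqr_nat => /eqP.
Qed.

(** The fraction [m/n] need not be in lowest terms. *)
Lemma rho_actionE (r : posrat) (m n : posint) x :
  r = (posrat_of m * (posrat_of n)^-1)%g ->
  rho_action r x = rho_inf m (sigma_inf n x).
Proof. by move=> /posrat_frac_cross; apply: rho_sigma. Qed.

Lemma rho_action_of n N f :
  rho_action (posrat_of n) (dl_in N f) = dl_in (pmul n N) f.
Proof.
have rE : posrat_of n = (posrat_of n * (posrat_of pone)^-1)%g.
  by apply: val_inj; rewrite /= invr1 mulr1.
by rewrite (rho_actionE _ rE) sigma_infE rho_infE sigma1.
Qed.

Lemma rho_action_ofV n N f :
  rho_action (posrat_of n)^-1%g (dl_in N f) = dl_in N (sigma n f).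
Proof.
have rE : (posrat_of n)^-1%g = (posrat_of pone * (posrat_of n)^-1)%g.
  by apply: val_inj; rewrite /= mul1r.
by rewrite (rho_actionE _ rE) sigma_infE rho_infE pmul1n.
Qed.

(** The images of the generators in the crossed product. *)
Definition gen_image (x : A_gen) : crossed rho_action :=
  match x with
  | GenH f => cp_coef rho_action (dl_in pone f)
  | GenMu (Mu n) => cp_unit rho_action (posrat_of n)
  | GenMu (MuStar n) => cp_unit rho_action (posrat_of n)^-1%g
  end.

Lemma cp_dl_conj (N : posint) (f : habiro) :
  cp_unit rho_action (posrat_of N) * cp_coef rho_action (dl_in pone f)
    * cp_unit rho_action (posrat_of N)^-1%g = cp_coef rho_action (dl_in N f).
Proof.
by rewrite [LHS]cp_coef_conj rho_action_of pmuln1.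
Qed.

Lemma crossed_sound e f :
  A_rel e f -> ring_eval gen_image e = ring_eval gen_image f.
Proof.
case=> [|{}f g|{}f g|n|n m|n m _|n|n {}f|n {}f|N M {}f g eq_fg];
  cbn [ring_eval gen_image mu_adj].
- by rewrite rmorph1 cp_coef1.
- by rewrite rmorphD cp_coefD.
- by rewrite rmorphM cp_coefM.
- by [].
- by rewrite posrat_ofM cp_unitM.
- by rewrite -[LHS]cp_unitM -[RHS]cp_unitM posrat_mulgC.
- by rewrite -[LHS]cp_unitM mulVg cp_unit1.
- by rewrite [LHS]cp_unit_coef rho_action_of dl_in_sigma.
- by rewrite [LHS]cp_unit_coef rho_action_ofV.
- by rewrite [LHS]cp_dl_conj [RHS]cp_dl_conj eq_fg.
Qed.

(** * The covariant pair in the presented ring *)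

Lemma A_relP e f : A_rel e f -> pr_class A_rel e = pr_class A_rel f.
Proof. by move=> ef; apply/pr_classP/cong_rel. Qed.

Lemma A_HD f g : A_H (f + g) = A_H f + A_H g.
Proof. by rewrite [LHS](A_relP (rel_HD f g)) -pr_addE. Qed.

Lemma A_HM f g : A_H (f * g) = A_H f * A_H g.
Proof. by rewrite [LHS](A_relP (rel_HM f g)) -pr_mulE. Qed.

Lemma A_H1 : A_H 1 = 1.
Proof. exact: A_relP rel_H1. Qed.

Lemma A_muM n m : A_mu (pmul n m) = A_mu n * A_mu m.
Proof. by rewrite -[LHS](A_relP (rel_mul n m)) -pr_mulE. Qed.

Lemma A_mus_mu n : A_mus n * A_mu n = 1.
Proof. by rewrite -[RHS](A_relP (rel_isom n)) -pr_mulE. Qed.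

Lemma A_mus_H n f : A_mus n * A_H f = A_H (sigma n f) * A_mus n.
Proof. by have := A_relP (rel_sigma_mu n f); rewrite -!pr_mulE. Qed.

Lemma A_dirlim N M f g : dl_in N f = dl_in M g ->
  A_mu N * A_H f * A_mus N = A_mu M * A_H g * A_mus M.
Proof. by move=> /rel_dirlim /A_relP; rewrite -!pr_mulE. Qed.

Lemma A_mu1 : A_mu pone = 1.
Proof. by rewrite -[LHS]mul1r -(A_mus_mu pone) -mulrA -A_muM pmul1n. Qed.

Lemma A_mus1 : A_mus pone = 1.
Proof. by rewrite -(A_mus_mu pone) A_mu1 mulr1. Qed.

(** The elements [dl_in n 1] and [dl_in pone 1] of the direct limit are equal,
    so that [mu_n mu_n^*] does not depend on [n]. *)
Lemma A_mu_mus n : A_mu n * A_mus n = 1.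
Proof.
have eq1 : dl_in n 1 = dl_in pone 1 by rewrite !rmorph1.
by have := A_dirlim eq1; rewrite A_H1 A_mu1 A_mus1 !mulr1.
Qed.

Lemma A_muC n m : A_mu n * A_mu m = A_mu m * A_mu n.
Proof. by rewrite -!A_muM pmulC. Qed.

Lemma A_mu_musC n m : A_mu n * A_mus m = A_mus m * A_mu n.
Proof.
rewrite -[LHS]mul1r -(A_mus_mu m) -mulrA [A_mu m * _]mulrA A_muC.
by rewrite -!mulrA A_mu_mus mulr1.
Qed.

Lemma A_musM n m : A_mus (pmul n m) = A_mus n * A_mus m.
Proof.
rewrite -[RHS]mulr1 -(A_mu_mus (pmul n m)) pmulC A_muM !mulrA.
by rewrite -(mulrA _ (A_mus m)) A_mus_mu mulr1 A_mus_mu mul1r.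
Qed.

(** The image of a positive rational [m/n] (in lowest terms): [mu_m mu_n^*]. *)
Definition A_frac (r : posrat) : A_Zq :=
  A_mu (posrat_num r) * A_mus (posrat_den r).

(** The fraction [m/n] need not be in lowest terms. *)
Lemma A_fracE (r : posrat) (m n : posint) :
  r = (posrat_of m * (posrat_of n)^-1)%g -> A_frac r = A_mu m * A_mus n.
Proof.
move=> /posrat_frac_cross e; set a := posrat_num r in e; set b := posrat_den r in e.
have {}e : pmul a n = pmul m b by apply: posint_inj.
rewrite /A_frac -/a -/b -[A_mu a]mulr1 -(A_mu_mus n) mulrA -A_muM e A_muM.
by rewrite -!mulrA -A_musM pmulC A_musM [A_mu b * _]mulrA A_mu_mus mul1r.
Qed.

Lemma A_frac1 : A_frac 1%g = 1.
Proof.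
rewrite (A_fracE (m := pone) (n := pone)) ?A_mu_mus //.
by rewrite mulgV.
Qed.

Lemma A_fracM (r s : posrat) : A_frac (r * s)%g = A_frac r * A_frac s.
Proof.
set m := posrat_num r; set n := posrat_den r.
set m' := posrat_num s; set n' := posrat_den s.
rewrite (A_fracE (m := pmul m m') (n := pmul n n')).
  rewrite /A_frac A_muM A_musM -/m -/n -/m' -/n'.
  by rewrite -!mulrA [A_mu m' * (_ * _)]mulrA A_mu_musC !mulrA.
apply: val_inj; rewrite [X in (X * _)%g]posrat_fracE [X in (_ * X)%g]posrat_fracE.
by rewrite /= !natrM invfM mulrACA.
Qed.

(** The image of the direct limit: [(N, f)] is sent to [mu_N f mu_N^*]. *)
Definition A_dl (x : habiro_inf) : A_Zq :=
  let: (N, f) := repr x in A_mu N * A_H f * A_mus N.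

Lemma A_dlE N f : A_dl (dl_in N f) = A_mu N * A_H f * A_mus N.
Proof.
have [M [g [eMg /dl_inP eq_dl]]] := dl_repr N f.
by rewrite /A_dl eMg; apply: A_dirlim.
Qed.

Fact A_dl_is_zmod_morphism : zmod_morphism A_dl.
Proof.
have A_HB f g : A_H (f - g) = A_H f - A_H g.
  by apply: (addIr (A_H g)); rewrite -A_HD !subrK.
apply: dl_ind2 => N f g.
by rewrite -rmorphB !A_dlE A_HB mulrBr mulrBl.
Qed.

Fact A_dl_is_monoid_morphism : monoid_morphism A_dl.
Proof.
split; first by rewrite -(rmorph1 (dl_in pone)) A_dlE A_H1 mulr1 A_mu_mus.
apply: dl_ind2 => N f g; rewrite -rmorphM !A_dlE A_HM !mulrA.
by rewrite -(mulrA _ (A_mus N) (A_mu N)) A_mus_mu mulr1.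
Qed.

HB.instance Definition _ := GRing.isZmodMorphism.Build _ _ A_dl
  A_dl_is_zmod_morphism.
HB.instance Definition _ := GRing.isMonoidMorphism.Build _ _ A_dl
  A_dl_is_monoid_morphism.

Lemma A_mus_dl n x : A_mus n * A_dl x = A_dl (sigma_inf n x) * A_mus n.
Proof.
elim/dl_ind: x => N f; rewrite sigma_infE !A_dlE !mulrA -A_mu_musC.
by rewrite -(mulrA _ (A_mus n)) A_mus_H -!mulrA -!A_musM pmulC.
Qed.

Lemma A_mu_dl n x : A_mu n * A_dl x = A_dl (rho_inf n x) * A_mu n.
Proof.
elim/dl_ind: x => N f; rewrite rho_infE !A_dlE [pmul n N]pmulC A_musM.
by rewrite -!mulrA A_mus_mu mulr1 pmulC A_muM !mulrA.
Qed.

Lemma A_frac_dl r x : A_frac r * A_dl x = A_dl (rho_action r x) * A_frac r.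
Proof. by rewrite /A_frac -mulrA A_mus_dl mulrA A_mu_dl mulrA. Qed.

Lemma A_frac_of n : A_frac (posrat_of n) = A_mu n.
Proof.
rewrite (A_fracE (m := n) (n := pone)); last by apply: val_inj; rewrite /= invr1 mulr1.
by rewrite A_mus1 mulr1.
Qed.

Lemma A_frac_ofV n : A_frac (posrat_of n)^-1%g = A_mus n.
Proof.
rewrite (A_fracE (m := pone) (n := n)); last by apply: val_inj; rewrite /= mul1r.
by rewrite A_mu1 mul1r.
Qed.

(** * The isomorphism *)

Theorem theorem2p7 :
  exists Phi : {rmorphism A_Zq -> crossed rho_action},
    [/\ bijective Phi,
        forall f : habiro, Phi (A_H f) = cp_coef rho_action (dl_in pone f),
        forall n : posint, Phi (A_mu n) = cp_unit rho_action (posrat_of n),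
        forall n : posint,
          Phi (A_mus n) = cp_unit rho_action (posrat_of n)^-1%g
      & forall (N : posint) (f : habiro),
          Phi (A_mu N * A_H f * A_mus N) = cp_coef rho_action (dl_in N f)].
Proof.
have [Phi PhiE] := presented_lift crossed_sound.
have [Psi PsiE] := crossed_lift A_frac1 A_fracM A_frac_dl.
have PhiH f : Phi (A_H f) = cp_coef rho_action (dl_in pone f) by apply: PhiE.
have Phimu n : Phi (A_mu n) = cp_unit rho_action (posrat_of n) by apply: PhiE.
have Phimus n : Phi (A_mus n) = cp_unit rho_action (posrat_of n)^-1%g.
  exact: PhiE.
have PhiC N f :
    Phi (A_mu N * A_H f * A_mus N) = cp_coef rho_action (dl_in N f).
  by rewrite !rmorphM /= PhiH Phimu Phimus cp_dl_conj.
have {}PsiE a r : Psi << a *g r >> = A_dl a * A_frac r by apply: PsiE.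
exists Phi; split; [|exact: PhiH|exact: Phimu|exact: Phimus|exact: PhiC].
exists Psi.
- apply: (@presented_morph_ext _ _ _ (Psi \o Phi) idfun) => -[f|[n|n]] /=.
  + rewrite PhiH PsiE A_frac1 mulr1 A_dlE A_mu1 mul1r.
    by rewrite A_mus1 mulr1.
  + by rewrite Phimu PsiE rmorph1 mul1r A_frac_of.
  + by rewrite Phimus PsiE rmorph1 mul1r A_frac_ofV.
- apply: (@crossed_morph_ext _ _ _ _ (Phi \o Psi) idfun) => a r /=.
  rewrite PsiE rmorphM /=; elim/dl_ind: a => N f; rewrite A_dlE PhiC.
  rewrite /A_frac rmorphM /= Phimu Phimus.
  rewrite -[X in _ * X = _]cp_unitM -posrat_fracE.
  exact: cp_coef_unit.
Qed.
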